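(* Let $\nu$ be a translation-invariant nonnegative valuation and let $\mathcal{P}\subset\mathbf{R}^d$ be a $d$-dimensional lattice polytope. Define $N_{\mathcal{P}}(t):=\sum_{\mathbf{x}\in\mathbf{Z}^d}\nu(t\mathcal{P},\mathbf{x})$ and $G_{\mathcal{P}}(z):=\sum_{t\ge0}N_{\mathcal{P}}(t)\,z^t$, and write \[ G_{\mathcal{P}}(z)=\frac{a_dz^d+a_{d-1}z^{d-1}+\cdots+a_0}{(1-z)^{d+1}}. \] Then $a_j\ge0$ for $j=0,1,\dots,d$.
   Context: A lattice polytope is a convex polytope with all vertices in $\mathbf{Z}^d$; $t\mathcal{P}=\{t\mathbf{x}:\mathbf{x}\in\mathcal{P}\}$. A valuation is a function $\nu(K,\mathbf{x})$, defined for $K$ ranging over polyhedral complexes (finite unions of polytopes) in $\mathbf{R}^d$ and $\mathbf{x}\in\mathbf{R}^d$, with real values, satisfying inclusion–exclusion: $\nu(K_1\cup K_2,\mathbf{x})=\nu(K_1,\mathbf{x})+\nu(K_2,\mathbf{x})-\nu(K_1\cap K_2,\mathbf{x})$. It is nonnegative if all its values are $\ge0$, and translation-invariant if $\nu(K+\mathbf{y},\mathbf{x}+\mathbf{y})=\nu(K,\mathbf{x})$ for all $K$ and all $\mathbf{x},\mathbf{y}\in\mathbf{R}^d$. (Examples: the solid angle $\omega_K(\mathbf{x})$, or the indicator of $\mathbf{x}\in K\cap\mathbf{Z}^d$.) By a theorem of McMullen, for a lattice polytope $N_{\mathcal{P}}(t)$ (defined for positive integers $t$) agrees with a polynomial in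 $t$; $N_{\mathcal{P}}(0)$ denotes the value of this polynomial at $0$, and equivalently $G_{\mathcal{P}}(z)$ is a rational function with denominator $(1-z)^{d+1}$ and numerator of degree at most $d$.
   Formalization: The valuation is required to be defined, additive, translation-invariant and nonnegative also on half-open polytopes (differences of finite unions of polytopes), since with closed ones only the claim fails for d=1; the sums N_P(t), t>0, are assumed finite. *)

(* Defs.v *)
From HB Require Import structures.
From mathcomp Require Import all_boot all_order all_algebra.
From mathcomp Require Import all_classical all_reals all_analysis.

Set Implicit Arguments.
Unset Strict Implicit.
Unset Printing Implicit Defensive.

Import Order.TTheory GRing.Theory Num.Theory.

Local Open Scope classical_set_scope.
Local Open Scope ring_scope.

Section Polytopes.
Context {R : realType} {d : nat}.
Implicit Types (A K P : set 'rV[R]_d) (x y z : 'rV[R]_d).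

Definition aff_hull A : set 'rV[R]_d :=
  [set x | exists n (l : 'I_n -> R) (v : 'I_n -> 'rV[R]_d),
     [/\ forall i, A (v i), \sum_i l i = 1 & x = \sum_i l i *: v i]].

Definition conv_hull A : set 'rV[R]_d :=
  [set x | exists n (l : 'I_n -> R) (v : 'I_n -> 'rV[R]_d),
     [/\ forall i, A (v i), forall i, 0 <= l i, \sum_i l i = 1
       & x = \sum_i l i *: v i]].

Definition polytope P := exists2 A, finite_set A & P = conv_hull A.

(* Vertices are the extreme points. *)
Definition vertex P x :=
  P x /\ forall y z (s : R), P y -> P z -> 0 < s < 1 ->
         x = s *: y + (1 - s) *: z -> y = x /\ z = x.

Definition int_vec : set 'rV[R]_d :=
  [set x | forall j, x 0 j \is a Num.int].

Definition lattice_polytope P := polytope P /\ vertex P `<=` int_vec.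

Definition full_dimensional P := aff_hull P = setT.

Definition dilate (t : nat) P : set 'rV[R]_d := [set t%:R *: x | x in P].

Definition translate y K : set 'rV[R]_d := [set x + y | x in K].

(* The domain of valuations: the smallest family of sets containing the
   polytopes and closed under finite unions and differences, i.e. finite unions
   of polytopes that may lack some of their faces.  Half-open cells have to be
   included: with finite unions of closed polytopes only, positivity fails.
   For d = 1, let nu K x be 0 if x is not in K, and otherwise the number of
   sides (left, right) on which K contains no interval starting at x.  On finite
   unions of compact intervals this satisfies inclusion-exclusion, is
   translation-invariant and is nonnegative, but the sum for t [0, 1] is 2 for
   every t > 0, and its series is (2 - 2 z) / (1 - z) ^ 2. *)
Definition polyhedral : set (set 'rV[R]_d) := <<r [set P | polytope P] >>.

(* Valuations are total functions; only their values at polyhedral sets are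
   meaningful. *)
Implicit Type nu : set 'rV[R]_d -> 'rV[R]_d -> R.

Definition valuation nu := forall K1 K2 x, polyhedral K1 -> polyhedral K2 ->
  nu (K1 `|` K2) x = nu K1 x + nu K2 x - nu (K1 `&` K2) x.

Definition nonnegative_valuation nu :=
  forall K x, polyhedral K -> 0 <= nu K x.

Definition translation_invariant nu := forall K x y, polyhedral K ->
  nu (translate y K) (x + y) = nu K x.

(* Used for t > 0 only: the value at 0 is that of the interpolating
   polynomial. *)
Definition lattice_sum nu P (t : nat) : \bar R :=
  (\esum_(x in int_vec) (nu (dilate t P) x)%:E)%E.

End Polytopes.

(* Product of the formal power series \sum_n (f n) z^n and \sum_n (g n) z^n. *)
Definition fps_mul {R : realType} (f g : nat -> R) (n : nat) : R :=
  \sum_(i < n.+1) f i * g (n - i)%N.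

(* Main.v *)
(** Heights in general position on the vertices of [P] induce a triangulation
    of [P] into lattice simplices; removing from each simplex the facets visible
    from a generic point of [P] makes these simplices disjoint, and never all
    facets of a simplex are removed.  Over a half-open simplex with vertices
    [v_0, ..., v_d], the half-open cone is tiled by the translates of its
    fundamental parallelepiped by nonnegative combinations of the [(v_i, 1)].
    Tiling in one direction [v_i] at a time, each step multiplies the generating
    function by [1 - z], by additivity and translation invariance.  Hence the
    coefficient [a_j] is the sum, over the simplices and the lattice points [x],
    of the values of [nu] at the [j]-th level of the parallelepiped, which is
    nonnegative, and which is empty for [j > d] because not all coordinates can
    reach [1]. *)
Require Import Defs.
From HB Require Import structures.
From mathcomp Require Import all_boot all_order all_algebra.
From mathcomp Require Import all_classical all_reals all_analysis.
From mathcomp Require Import lra.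

Set Implicit Arguments.
Unset Strict Implicit.
Unset Printing Implicit Defensive.

Import Order.TTheory GRing.Theory Num.Theory.

Local Open Scope classical_set_scope.
Local Open Scope ring_scope.

(** * Generic vectors and small perturbations *)

Section Genericity.
Context {R : realFieldType}.

(** The numbers [1, ..., size p] are too many to be all roots of a nonzero polynomial. *)
Lemma pos_nonroot (p : {poly R}) : p != 0 -> exists2 s : R, 0 < s & p.[s] != 0.
Proof.
move=> p0; apply: contrapT => h.
pose rs := [seq (i.+1)%:R : R | i <- iota 0 (size p)].
have : (size rs < size p)%N.
  apply: max_poly_roots => //.
    apply/allP => x /mapP [i _ ->]; apply/negPn/negP => px.
    by apply: h; exists i.+1%:R.
  by rewrite map_inj_uniq ?iota_uniq // => i j /eqP; rewrite eqr_nat => /eqP [].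
by rewrite size_map size_iota ltnn.
Qed.

(* The moment curve meets finitely many hyperplanes in finitely many points. *)
Lemma generic_weights (m : nat) (K : finType) (c : K -> 'rV[R]_m) :
  exists2 w : 'cV[R]_m, forall j, 0 < w j 0 &
    forall k, c k != 0 -> (c k *m w) 0 0 != 0.
Proof.
have [|s s0 hs] := @pos_nonroot (\prod_(k | c k != 0) rVpoly (c k)).
  apply/prodf_neq0 => k; apply: contraNneq => h.
  by rewrite -[c k]rVpolyK h linear0.
exists (\col_j s ^+ j) => [j|k ck]; first by rewrite mxE exprn_gt0.
move: hs; rewrite horner_prod => /prodf_neq0 /(_ k ck).
rewrite horner_poly mxE; congr (_ != _); apply: eq_bigr => i _.
by rewrite valK mxE.
Qed.

(** The inverse of any bound above all the ratios [|b k| / |a k|] is small enough for [e]; the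
    indices with [a k = 0] impose no condition. *)
Lemma perturbation (K : finType) (a b : K -> R) :
  exists2 e : R, 0 < e & forall k,
    (0 < a k -> 0 < a k + e * b k) /\ (a k < 0 -> a k + e * b k < 0).
Proof.
pose M := 1 + \sum_k `|b k| / `|a k|.
have bM k : `|b k| / `|a k| < M.
  rewrite /M (bigD1 k) //= addrCA ltrDl ltr_pwDl //.
  by apply: sumr_ge0 => i _; rewrite divr_ge0.
have M0 : 0 < M by rewrite ltr_pwDl //; apply: sumr_ge0 => i _; rewrite divr_ge0.
exists M^-1; first by rewrite invr_gt0.
move=> k.
have h : a k != 0 -> `|M^-1 * b k| < `|a k|.
  rewrite -normr_gt0 => a0.
  rewrite normrM gtr0_norm ?invr_gt0 // mulrC ltr_pdivrMr //.
  by rewrite mulrC -ltr_pdivrMr.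
split=> ak.
  have := h (lt0r_neq0 ak); rewrite (gtr0_norm ak) ltr_norml => /andP [? _]; lra.
have := h (ltr0_neq0 ak); rewrite (ltr0_norm ak) ltr_norml => /andP [_ ?]; lra.
Qed.

End Genericity.

(** * Bases among the rows of a matrix, pivoting, and lower-hull triangulations *)

Section Bases.
Context {R : realFieldType} {m D : nat}.
Implicit Types (T S : {set 'I_m}) (c : 'rV[R]_m) (U : 'M[R]_(m, D)).

Definition supp T c := forall i, i \notin T -> c 0 i = 0.

(** Linear independence of the rows indexed by [T]. Coefficient vectors keep the full index set
    ['I_m] and vanish outside [T], so that different bases can be compared without reindexing. *)
Definition indep U T := forall c, supp T c -> c *m U = 0 -> c = 0.

Definition coord_mx U T (C : 'M[R]_m) :=
  C *m U = U /\ forall j i, i \notin T -> C j i = 0.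

Definition basis U T := indep U T /\ exists C, coord_mx U T C.

(* Row [j] holds the coordinates of [row j U] in the basis [T]. *)
Definition coords U T : 'M[R]_m := xget 0 [set C | coord_mx U T C].

Lemma coordsP U T : basis U T -> coord_mx U T (coords U T).
Proof. by case=> _ [C hC]; apply: (@xgetPex _ 0 [set C | coord_mx U T C]); exists C. Qed.

Lemma suppD T c c' : supp T c -> supp T c' -> supp T (c + c').
Proof. by move=> h h' i iT; rewrite mxE h ?h' ?addr0. Qed.

Lemma suppZ T a c : supp T c -> supp T (a *: c).
Proof. by move=> h i iT; rewrite mxE h ?mulr0. Qed.

Lemma suppN T c : supp T c -> supp T (- c).
Proof. by move=> h i iT; rewrite mxE h ?oppr0. Qed.

Lemma supp_delta T j : j \in T -> supp T (delta_mx 0 j).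
Proof.
by move=> jT i iT; rewrite mxE eqxx /=; case: eqP iT => // ->; rewrite jT.
Qed.

Lemma supp_sub T S c : T \subset S -> supp T c -> supp S c.
Proof. by move=> TS h i iS; apply: h; apply: contraNN iS; apply: (fintype.subsetP TS). Qed.

Lemma indep_inj U T c c' : indep U T -> supp T c -> supp T c' ->
  c *m U = c' *m U -> c = c'.
Proof.
move=> iT h h' e; apply/eqP; rewrite -subr_eq0; apply/eqP; apply: iT.
  by apply: suppD => //; apply: suppN.
by rewrite mulmxBl e subrr.
Qed.

Lemma indep_sub U T S : T \subset S -> indep U S -> indep U T.
Proof. by move=> TS iS c hc; apply: iS; apply: supp_sub hc. Qed.

Lemma supp_coords U T c : basis U T -> supp T (c *m coords U T).
Proof.
move=> bT i iT; rewrite mxE big1 // => j _.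
by rewrite (proj2 (coordsP bT)) ?mulr0.
Qed.

Lemma coords_mulmx U T c : basis U T -> c *m coords U T *m U = c *m U.
Proof. by move=> bT; rewrite -mulmxA (proj1 (coordsP bT)). Qed.

Lemma coords_id U T c : basis U T -> supp T c -> c *m coords U T = c.
Proof.
move=> bT hc; apply: (indep_inj (proj1 bT)) => //; first exact: supp_coords.
exact: coords_mulmx.
Qed.

Lemma coords_eq U T c c' : basis U T -> supp T c -> c *m U = c' *m U ->
  c = c' *m coords U T.
Proof.
move=> bT hc e; apply: (indep_inj (proj1 bT)) => //; first exact: supp_coords.
by rewrite coords_mulmx.
Qed.

(** A maximal independent set containing [S] spans: adjoining any further row creates a relation
    that can be solved for that row. *)
Lemma basis_ext U S : indep U S -> exists2 T : {set 'I_m}, S \subset T & basis U T.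
Proof.
move=> iS.
have [T /maxsetP [/asboolP iT mT] ST] :=
  @maxset_exists _ (fun A => `[<indep U A>]) S (asboolT iS).
exists T => //; split=> //.
have /choice [r hr] : forall j, exists r : 'rV[R]_m, supp T r /\ r *m U = row j U.
  move=> j; have [jT|jT] := boolP (j \in T).
    by exists (delta_mx 0 j); split; [exact: supp_delta|rewrite -rowE].
  have : ~ indep U (j |: T).
    move=> h; have := mT _ (asboolT h) (finset.subsetUr _ _).
    by move=> e; move: jT; rewrite -e setU11.
  move/existsNP => [c /not_implyP [hc /not_implyP [cU c0]]].
  have cj : c 0 j != 0.
    apply: contra_notN c0 => /eqP cj; apply: iT => // i iT.
    have [->//|ij] := eqVneq i j.
    by apply: hc; rewrite !inE negb_or ij.
  exists (delta_mx 0 j - (c 0 j)^-1 *: c); split.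
    move=> i niT; rewrite !mxE eqxx /=.
    have [->|ij] := eqVneq i j; first by rewrite mulVf // subrr.
    by rewrite (hc i) ?mulr0 ?subr0 // !inE negb_or ij.
  by rewrite mulmxBl -scalemxAl cU scaler0 subr0 -rowE.
exists (\matrix_j r j); split.
  by apply/row_matrixP => j; rewrite row_mul rowK (proj2 (hr j)).
by move=> j i niT; rewrite mxE (proj1 (hr j)).
Qed.

(** The rows indexed by [T] form a free matrix with the row space of [U], so its rank is both [#|T|]
    and [D]. *)
Lemma card_basis U T : row_full U -> basis U T -> #|T| = D.
Proof.
move=> fU [iT [C [CU hC]]].
pose B := rowsub (@enum_val _ (mem T)) U.
pose E : 'M[R]_(#|T|, m) := rowsub (@enum_val _ (mem T)) 1%:M.
have BE : B = E *m U by rewrite /B -[in LHS](mul1mx U) mul_rowsub_mx.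
have kE (k : 'rV[R]_#|T|) i : (k *m E) 0 (enum_val i) = k 0 i.
  rewrite mxE (bigD1 i) //= !mxE eqxx mulr1 big1 ?addr0 // => j ji.
  by rewrite !mxE (inj_eq enum_val_inj) (negbTE ji) mulr0.
have fB : row_free B.
  apply: inj_row_free => k; rewrite BE mulmxA => /(iT _) e.
  apply/rowP => i; rewrite mxE -kE e ?mxE // => l lT.
  rewrite mxE big1 // => j _; rewrite !mxE.
  by case: eqP => [ej|]; rewrite ?mulr0 //; move: lT; rewrite -ej enum_valP.
have UB : (U <= B)%MS.
  apply/submxP; exists (\matrix_(j, i) C j (enum_val i)).
  rewrite -[LHS]CU BE mulmxA; congr (_ *m _).
  apply/matrixP => j l; rewrite mxE.
  have [lT|lT] := boolP (l \in T).
    rewrite (bigD1 (enum_rank_in lT l)) //= !mxE enum_rankK_in // eqxx mulr1.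
    rewrite big1 ?addr0 // => i ni; rewrite !mxE; case: eqP => [e|]; rewrite ?mulr0 //.
    by case/eqP: ni; apply: enum_val_inj; rewrite enum_rankK_in.
  rewrite hC // big1 // => i _; rewrite !mxE; case: eqP => [e|]; rewrite ?mulr0 //.
  by move: lT; rewrite -e enum_valP.
have : \rank B = D.
  apply/eqP; rewrite eqn_leq rank_leq_col /=.
  by rewrite -{1}(eqP fU) mxrankS.
by rewrite (eqP fB).
Qed.

(** The ratio test of the simplex method: moving from [l] along [- c], the step is stopped when the
    first coordinate reaches 0, that is, at the least ratio over the positive coordinates of [c]. *)
Lemma ratio_test (l c : 'rV[R]_m) : (forall i, 0 <= l 0 i) ->
  (exists i, 0 < c 0 i) ->
  exists2 i0, 0 < c 0 i0 &
    forall i, 0 <= (l - (l 0 i0 / c 0 i0) *: c) 0 i.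
Proof.
move=> l0 [i1 ci1].
pose f i := l 0 i / c 0 i.
have [i0 ci0 hmin] := @arg_minP _ _ _ i1 (fun i => 0 < c 0 i) f ci1.
exists i0 => // i; rewrite !mxE subr_ge0.
have [ci|ci] := ltP 0 (c 0 i); first by rewrite -ler_pdivlMr //; exact: hmin.
by apply: le_trans (l0 i); rewrite mulr_ge0_le0 // divr_ge0 // ltW.
Qed.

Lemma ratio_test0 (l c : 'rV[R]_m) i : 0 < c 0 i ->
  (l - (l 0 i / c 0 i) *: c) 0 i = 0.
Proof. by move=> ci; rewrite !mxE divfK ?subrr // lt0r_neq0. Qed.

(** * Configurations in an open half-space: Carathéodory's theorem *)

Section Pointed.
Variables (U : 'M[R]_(m, D)) (h : 'cV[R]_D).
Hypothesis Uh : forall i, 0 < (U *m h) i 0.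

(** Pairing a relation without positive coefficients with [h] gives a vanishing sum of nonpositive
    terms, which forces every coefficient to be 0. *)
Lemma circuit_pos c : c != 0 -> c *m U = 0 -> exists i, 0 < c 0 i.
Proof.
move=> c0 cU; apply: contrapT => hn; move/eqP: c0; apply.
have hc i : c 0 i <= 0 by rewrite leNgt; apply/negP => ?; apply: hn; exists i.
have : (c *m (U *m h)) 0 0 = 0 by rewrite mulmxA cU mul0mx mxE.
rewrite mxE => /eqP; rewrite -oppr_eq0 -sumrN psumr_eq0 => [/allP e|i _].
  apply/rowP => i; have := e i (mem_index_enum _).
  by rewrite oppr_eq0 mulf_eq0 (gt_eqF (Uh i)) orbF mxE => /eqP.
by rewrite oppr_ge0 mulr_le0_ge0 // ltW.
Qed.

(** Induction on the size of the support: while it is dependent, the ratio test along a relation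
    inside it kills one coefficient and creates none. *)
Lemma caratheodory c : (forall i, 0 <= c 0 i) ->
  exists T c', [/\ indep U T, supp T c', forall i, 0 <= c' 0 i
    & c' *m U = c *m U].
Proof.
have [n] := ubnP #|[set i | c 0 i != 0]%SET|; elim: n c => // n IH c.
set S := [set i | c 0 i != 0]%SET => hn c0.
have hS : supp S c by move=> i; rewrite inE negbK => /eqP.
have [iS|] := pselect (indep U S); first by exists S, c.
move/existsNP => [k /not_implyP [hk /not_implyP [kU /eqP k0]]].
have [i0 ki0 hc] := ratio_test c0 (circuit_pos k0 kU).
have [|//|T [c' [? ? ? e]]] := IH (c - (c 0 i0 / k 0 i0) *: k).
  apply: leq_trans (_ : #|S| <= _)%N; last by rewrite -ltnS.
  apply: proper_card; apply/properP; split.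
    apply/fintype.subsetP => i; rewrite inE; apply: contraNT => iS.
    by rewrite !mxE (hS i) // (hk i) // mulr0 subr0.
  exists i0; last by rewrite inE ratio_test0 ?eqxx.
  by apply: contraTT ki0 => /hk ->; rewrite ltxx.
by exists T, c'; split=> //; rewrite e mulmxBl -scalemxAl kU scaler0 subr0.
Qed.

End Pointed.

(* [T] spans a cell of the lower hull of the points lifted to heights [w]. *)
Definition lower U (w : 'cV[R]_m) T :=
  basis U T /\ forall j, j \notin T -> (coords U T *m w) j 0 < w j 0.

(** Rows outside [T] are lifted strictly above the hyperplane through the lifted rows of [T]; any
    weight on them is therefore paid for in height. *)
Lemma lower_cost U w T (c : 'rV[R]_m) : lower U w T -> (forall i, 0 <= c 0 i) ->
  (c *m coords U T *m w) 0 0 <= (c *m w) 0 0 ?= iff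
  [forall j, (c 0 j != 0) ==> (j \in T)].
Proof.
move=> [bT lT] c0; rewrite -mulmxA.
have hr (A : 'cV[R]_m) j : A j 0 = row j A 0 0 by rewrite mxE.
have hle j : (coords U T *m w) j 0 <= w j 0 ?= iff (j \in T).
  have [jT|/lT jT] := boolP (j \in T); last by split; [exact: ltW|rewrite lt_eqF].
  have -> : (coords U T *m w) j 0 = w j 0.
    have := coords_id bT (supp_delta jT); rewrite -rowE => e.
    by rewrite 2!hr row_mul e -rowE.
  by split; rewrite ?eqxx.
rewrite !mxE.
have := @leif_sum R 'I_m xpredT (fun j => (c 0 j == 0) || (j \in T))
   (fun j => c 0 j * (coords U T *m w) j 0) (fun j => c 0 j * w j 0).
have -> : [forall j, (c 0 j != 0) ==> (j \in T)] =
  [forall (j | true), (c 0 j == 0) || (j \in T)].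
  by apply: eq_forallb => j; rewrite implyNb.
apply=> j _; have [->|cj] := eqVneq (c 0 j) 0; first by rewrite !mul0r; split; rewrite ?lexx ?eqxx.
by split; [rewrite ler_wpM2l // hle|rewrite (inj_eq (mulfI cj)) (hle j).2].
Qed.

(** By [lower_cost] each representation is at most as high as the other. The heights agree, and the
    equality case puts each support inside the other. *)
Lemma lower_unique U w T S (c c' : 'rV[R]_m) :
  lower U w T -> lower U w S -> supp T c -> supp S c' ->
  (forall i, i \in T -> 0 < c 0 i) -> (forall i, i \in S -> 0 < c' 0 i) ->
  c *m U = c' *m U -> T = S.
Proof.
move=> lT lS hc hc' c0 c'0 e.
have ge0 A a : supp A a -> (forall i, i \in A -> 0 < a 0 i) ->
    forall i, 0 <= a 0 i.
  by move=> hA hp i; have [/hp/ltW|/hA ->] := boolP (i \in A).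
have := lower_cost lT (ge0 _ _ hc' c'0).
rewrite -(coords_eq (proj1 lT) hc e) => -[h1 eq1].
have := lower_cost lS (ge0 _ _ hc c0).
rewrite -(coords_eq (proj1 lS) hc' (esym e)) => -[h2 eq2].
have E : (c *m w) 0 0 = (c' *m w) 0 0 by apply/eqP; rewrite eq_le h1 h2.
move: eq1 eq2; rewrite E eqxx => /esym/forallP h /esym/forallP h'.
apply/eqP; rewrite finset.eqEsubset; apply/andP; split; apply/fintype.subsetP => i iA.
  by move: (h' i); rewrite lt0r_neq0 ?c0.
by move: (h i); rewrite lt0r_neq0 ?c'0.
Qed.

Lemma basis_pivot U T (c : 'rV[R]_m) i j : basis U T ->
  supp (j |: T) c -> c *m U = 0 -> c 0 j != 0 -> j \notin T ->
  i \in T -> c 0 i != 0 -> basis U (j |: (T :\ i)).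
Proof.
move=> [iT [C [CU hC]]] hc cU cj jT iiT ci; split.
  move=> k hk kU.
  (* Matching the coefficients at [j] leaves a relation supported on [T], which must vanish. *)
  have e : k = (k 0 j / c 0 j) *: c.
    apply/eqP; rewrite -subr_eq0; apply/eqP; apply: iT; last first.
      by rewrite mulmxBl -scalemxAl cU kU scaler0 subr0.
    move=> l lT; rewrite !mxE.
    have [->|lj] := eqVneq l j; first by rewrite divfK // subrr.
    rewrite (hk l); last by rewrite !inE negb_or negb_and lT orbT andbT.
    by rewrite (hc l) ?mulr0 ?subrr // !inE negb_or lT andbT.
  have /eqP : k 0 i = 0.
    apply: hk; rewrite !inE eqxx /= orbF.
    by apply: contraNneq jT => <-.
  rewrite e mxE mulf_eq0 (negbTE ci) orbF => /eqP ->; exact: scale0r.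
(* From each row of [C] the multiple of the relation [c] that cancels column [i] is subtracted. *)
exists (C - (\col_l (C l i / c 0 i)) *m c); split.
  by rewrite mulmxBl -mulmxA cU mulmx0 subr0.
move=> l k; rewrite !inE negb_or negb_and negbK => /andP [kj].
rewrite !mxE big_ord1 !mxE; have [->|ki] /= := eqVneq k i.
  by rewrite divfK // subrr.
move=> kT; have -> : c ord0 k = 0 by apply: hc; rewrite !inE negb_or kj.
by rewrite hC // mulr0 subrr.
Qed.

(** The simplex method: a basis of least height among those with nonnegative coordinates is a lower
    cell, because a row lifted below its hyperplane could be pivoted in to decrease the height.
    Genericity of [w] excludes ties in height, and that of [c] excludes pivots of length 0. *)
Lemma lower_exists U (h : 'cV[R]_D) w c :
  (forall i, 0 < (U *m h) i 0) ->
  (forall T j, basis U T -> j \notin T -> (coords U T *m w) j 0 != w j 0) ->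
  (forall i, 0 <= c 0 i) ->
  (forall T i, basis U T -> i \in T -> (c *m coords U T) 0 i != 0) ->
  exists2 T, lower U w T & forall i, i \in T -> 0 < (c *m coords U T) 0 i.
Proof.
move=> Uh gw c0 gc.
pose feas T := `[<basis U T /\ forall i, 0 <= (c *m coords U T) 0 i>].
have [T1 fT1] : exists T, feas T.
  have [S [c' [iS hS c'0 e]]] := caratheodory Uh c0.
  have [T ST bT] := basis_ext iS; exists T; apply/asboolP; split=> // i.
  by rewrite -(coords_eq bT (supp_sub ST hS) e).
have [T /asboolP [bT T0] Tmin] :=
  arg_minP (fun T => (c *m coords U T *m w) 0 0) fT1.
exists T => [|i iT]; last by rewrite lt0r gc ?T0.
split=> // j jT; rewrite lt_neqAle gw //= leNgt; apply/negP => cost.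
(* The relation that expresses row [j] in the basis [T]. Subtracting [th *: k] raises coordinate [j]
   from 0 to [th], and the row [i] chosen by the ratio test leaves the basis. *)
pose k := row j (coords U T) - delta_mx 0 j.
have kU : k *m U = 0 by rewrite mulmxBl -row_mul (proj1 (coordsP bT)) -rowE subrr.
have kj : k 0 j = -1.
  by rewrite !mxE (proj2 (coordsP bT)) // !eqxx sub0r.
have hk : supp (j |: T) k.
  move=> i; rewrite !inE negb_or => /andP [ij iT].
  by rewrite !mxE (proj2 (coordsP bT)) // (negbTE ij) andbF subr0.
have k0 : k != 0.
  by apply/eqP => /rowP /(_ j); rewrite kj mxE => /eqP; rewrite oppr_eq0 oner_eq0.
have [i ki hpos] := ratio_test T0 (circuit_pos Uh k0 kU).
have ij : i != j by apply: contraTneq ki => ->; rewrite kj oppr_gt0 ltr10.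
have iT : i \in T.
  by apply: contraTT ki => iT; rewrite hk ?ltxx // !inE negb_or ij.
have bS : basis U (j |: (T :\ i)).
  by apply: (basis_pivot bT hk kU) => //; rewrite ?kj ?oppr_eq0 ?oner_eq0 // lt0r_neq0.
set th := (_ / _) in hpos.
have th0 : 0 < th by rewrite divr_gt0 // lt0r gc ?T0.
have e : c *m coords U T - th *: k = c *m coords U (j |: (T :\ i)).
  apply: (coords_eq bS); last first.
    by rewrite mulmxBl coords_mulmx // -scalemxAl kU scaler0 subr0.
  move=> l; rewrite !inE negb_or negb_and negbK => /andP [lj].
  have [-> _|li /= lT] := eqVneq l i; first by rewrite ratio_test0.
  have kl : k 0 l = 0 by apply: hk; rewrite !inE negb_or lj.
  rewrite [LHS]mxE [X in _ + X]mxE [X in _ - X]mxE kl mulr0 subr0.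
  exact: supp_coords.
have fS : feas (j |: (T :\ i)) by apply/asboolP; split=> // l; rewrite -e.
have := Tmin _ fS; rewrite -e mulmxBl -scalemxAl.
rewrite [leRHS]mxE [X in _ <= _ + X]mxE [X in _ <= _ - X]mxE.
rewrite leNgt gtrBl => /negP; apply; rewrite mulr_gt0 //.
rewrite mulmxBl -row_mul -rowE mxE [X in X + _]mxE [X in _ + X]mxE [X in _ - X]mxE.
by rewrite subr_gt0.
Qed.

(** The vanishing of coordinate [i] cuts out the facet opposite to vertex [i]; [I] lists the facets
    that are removed. *)
Definition low (I : {set 'I_m}) i (x : R) := if i \in I then 0 < x else 0 <= x.

Definition halfopen (I T : {set 'I_m}) (c : 'rV[R]_m) :=
  supp T c /\ forall i, i \in T -> low I i (c 0 i).

(* Removing the facets visible from the generic point [w^T *m U] makes the cells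
   of the lower hull disjoint: a point lies in the half-open cell exactly if the
   open cell contains the point pushed slightly towards [w^T *m U]. *)
Lemma halfopen_triangulation U (h : 'cV[R]_D) :
  (forall i, 0 < (U *m h) i 0) ->
  exists (tri : {set {set 'I_m}}) (I : {set 'I_m} -> {set 'I_m}),
  [/\ forall T, T \in tri -> basis U T,
      forall T, T \in tri -> T != finset.set0 -> ~~ (T \subset I T),
      forall c, (forall i, 0 <= c 0 i) -> exists T c',
        [/\ T \in tri, halfopen (I T) T c' & c' *m U = c *m U]
    & forall T S c c', T \in tri -> S \in tri -> halfopen (I T) T c ->
        halfopen (I S) S c' -> c *m U = c' *m U -> T = S].
Proof.
move=> Uh.
pose K : finType := ({set 'I_m} * 'I_m * bool)%type.
(* One generic [w] serves twice: the first family makes it generic as heights, the second makes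
   [w^T] a point with nonzero coordinates in every basis. *)
pose v (k : K) := if k.2 then delta_mx 0 k.1.2 - row k.1.2 (coords U k.1.1)
                  else (col k.1.2 (coords U k.1.1))^T.
have [w w0 gw] := generic_weights v.
pose q := w^T.
have gcost T j : basis U T -> j \notin T -> (coords U T *m w) j 0 != w j 0.
  move=> bT jT; have := gw (T, j, true); rewrite /v /=.
  have -> : (delta_mx 0 j - row j (coords U T)) != 0.
    apply/eqP => /rowP /(_ j); rewrite !mxE (proj2 (coordsP bT)) // !eqxx subr0.
    by move/eqP; rewrite oner_eq0.
  move=> /(_ isT); rewrite mulmxBl -row_mul -rowE mxE.
  rewrite [X in X + _]mxE [X in _ + X]mxE [X in _ - X]mxE subr_eq0.
  by apply: contraNneq => ->.
have gq T i : basis U T -> i \in T -> (q *m coords U T) 0 i != 0.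
  move=> bT iT; have := gw (T, i, false); rewrite /v /=.
  have -> : (col i (coords U T))^T != 0.
    apply/eqP => /rowP /(_ i); rewrite !mxE => e.
    have := coords_id bT (supp_delta iT); rewrite -rowE => /rowP /(_ i).
    by rewrite !mxE e !eqxx => /eqP; rewrite eq_sym oner_eq0.
  move=> /(_ isT); congr (_ != _); rewrite !mxE; apply: eq_bigr => j _.
  by rewrite !mxE mulrC.
pose tri : {set {set 'I_m}} := [set T | `[<lower U w T>]]%SET.
pose I T : {set 'I_m} := [set i | (q *m coords U T) 0 i < 0]%SET.
(* A small step towards [q] preserves the signs of nonzero coordinates and gives the vanishing ones
   the sign of [q]. The half-open conditions thus become strict positivity at the pushed point, for
   all bases at once. *)
have push (c : 'rV[R]_m) : exists2 e : R, 0 < e &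
    forall T i, basis U T -> i \in T ->
      ((c + e *: q) *m coords U T) 0 i != 0 /\
      low (I T) i ((c *m coords U T) 0 i) =
      (0 < ((c + e *: q) *m coords U T) 0 i).
  pose a (k : {set 'I_m} * 'I_m) := (c *m coords U k.1) 0 k.2.
  pose b (k : {set 'I_m} * 'I_m) := (q *m coords U k.1) 0 k.2.
  have [e e0 he] := perturbation a b.
  exists e => // T i bT iT; have := he (T, i); rewrite /a /b /=.
  have -> : ((c + e *: q) *m coords U T) 0 i =
      (c *m coords U T) 0 i + e * (q *m coords U T) 0 i.
    by rewrite mulmxDl -scalemxAl mxE [X in _ + X]mxE.
  rewrite /low inE.
  have := gq T i bT iT.
  set x := (c *m _) 0 i; set y := (q *m _) 0 i => y0 [h1 h2].
  have [xn|xp|x0] := ltgtP x 0.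
  - have := h2 xn => l; split; first by rewrite lt_eqF.
    by rewrite [RHS]ltNge (ltW l) /=; case: ifP => // _; rewrite ltNge ltW.
  - have := h1 xp => l; split; first by rewrite gt_eqF.
    by rewrite l; case: ifP.
  rewrite x0 !add0r; split; first by rewrite mulf_neq0 // gt_eqF.
  by rewrite pmulr_rgt0 //; case: ltgtP y0.
exists tri, I; split.
- by move=> T; rewrite inE => /asboolP [].
- move=> T; rewrite inE => /asboolP [bT _] T0; apply/negP => /fintype.subsetP TI.
  (* The weights of [q] are positive, so [h] is positive at [q *m U]; this is impossible if all
     coordinates of [q] in the basis [T] are negative. *)
  have : 0 < (q *m (U *m h)) 0 0.
    have /set0Pn [i iT] := T0.
    rewrite mxE (bigD1 i) //= ltr_pwDl //; first by rewrite mxE mulr_gt0.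
    by apply: sumr_ge0 => j _; rewrite mxE mulr_ge0 // ltW.
  rewrite mulmxA -(coords_mulmx _ bT) -mulmxA mxE ltNge => /negP; apply.
  rewrite -oppr_ge0 -sumrN; apply: sumr_ge0 => i _; rewrite oppr_ge0.
  have [/TI|iT] := boolP (i \in T).
    by rewrite inE => qi; rewrite nmulr_rle0 // ltW.
  by rewrite (supp_coords _ bT iT) mul0r.
- move=> c c0; have [e e0 he] := push c.
  have [||T lT hT] := lower_exists (c := c + e *: q) Uh gcost.
  + by move=> i; rewrite !mxE addr_ge0 // mulr_ge0 // ltW.
  + by move=> T i bT iT; case: (he T i bT iT).
  exists T, (c *m coords U T); have bT := proj1 lT; split.
  + by rewrite inE; apply/asboolP.
  + split; first exact: supp_coords.
    by move=> i iT; rewrite (he T i bT iT).2 hT.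
  by rewrite coords_mulmx.
move=> T S c c'; rewrite !inE => lT lS [hT pT] [hS pS] e.
have [bT bS] := (proj1 lT, proj1 lS).
have [ep e0 he] := push c.
have eS : c *m coords U S = c' by rewrite -(coords_eq bS hS (esym e)).
have eT := coords_id bT hT.
apply: (lower_unique lT lS (supp_coords (c + ep *: q) bT)
  (supp_coords (c + ep *: q) bS)).
- by move=> i iT; rewrite -(he T i bT iT).2 eT pT.
- by move=> i iS; rewrite -(he S i bS iS).2 eS pS.
by rewrite !coords_mulmx.
Qed.

End Bases.

(** * Multiplication by powers of [1 - z] and polynomial sequences *)

Section FiniteDifferences.
Context {R : realType}.
Implicit Types (f g : nat -> R) (p : {poly R}).

(** The coefficients of [1 - z] times the series of [f], which is extended by 0 to negative
    indices. *)
Definition bdiff f (n : nat) : R := f n - if n is k.+1 then f k else 0.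

Lemma fps_mulE p f n :
  fps_mul (fun i => p`_i) f n = (p * \poly_(i < n.+1) f i)`_n.
Proof.
rewrite coefM; apply: eq_bigr => i _.
by rewrite coef_poly ltnS leq_subr.
Qed.

Lemma fps_mul_bdiff p f n :
  fps_mul (fun i => (p * (1 - 'X))`_i) f n =
  fps_mul (fun i => p`_i) (bdiff f) n.
Proof.
rewrite fps_mulE -mulrA coefM; apply: eq_bigr => i _; congr (_ * _).
rewrite mulrBl mul1r coefB coefXM !coef_poly ltnS leq_subr /bdiff.
by case E: (n - i)%N => [|k] //=; rewrite ltnS (leq_trans (leqnSn k)) // -E leq_subr.
Qed.

Lemma fps_mul1 f n : fps_mul (fun i => (1 : {poly R})`_i) f n = f n.
Proof. by rewrite fps_mulE mul1r coef_poly ltnSn. Qed.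

(** The leading terms cancel in each ['X^i - ('X - 1) ^+ i]. *)
Lemma size_poly_bdiff p k : (size p <= k.+1)%N ->
  (size (p - (p \Po ('X - 1)))%R <= k)%N.
Proof.
move=> pk.
have s2 : size ('X - 1 : {poly R}) = 2 by rewrite -polyC1 size_XsubC.
have szX i : (size ('X^i - ('X - 1) ^+ i : {poly R})%R <= i)%N.
  rewrite subrXX opprB addrC subrK mul1r.
  apply: (leq_trans (size_sum _ _ _)); apply/bigmax_leqP => j _.
  apply: (leq_trans (size_polyMleq _ _)).
  rewrite size_polyXn -polyC1 size_exp_XsubC addSn /= addnS.
  by case: i j => [[]//|i] j /=; rewrite subnK // -ltnS.
have -> : p - (p \Po ('X - 1)) =
    \sum_(i < k.+1) p`_i *: ('X^i - ('X - 1) ^+ i).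
  have pE : p = \sum_(i < k.+1) p`_i *: 'X^i.
    rewrite -poly_def; apply/polyP => i; rewrite coef_poly.
    by case: ltnP => // ki; rewrite nth_default // (leq_trans pk).
  rewrite {1 2}pE raddf_sum /= -sumrB.
  by apply: eq_bigr => i _; rewrite comp_polyZ comp_Xn_poly -scalerBr.
apply: (leq_trans (size_sum _ _ _)); apply/bigmax_leqP => j _.
apply: (leq_trans (size_scale_leq _ _)); apply: (leq_trans (szX j)).
by rewrite -ltnS.
Qed.

Lemma fps_mul_poly p k n : (size p <= k)%N -> (k <= n)%N ->
  fps_mul (fun i => ((1 - 'X) ^+ k : {poly R})`_i) (fun t => p.[t%:R]) n = 0.
Proof.
elim: k p n => [|k IH] p n.
  by rewrite leqn0 size_poly_eq0 => /eqP -> _; rewrite fps_mul1 horner0.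
move=> pk kn; rewrite exprSr fps_mul_bdiff.
apply: etrans (IH _ n (size_poly_bdiff pk) (ltnW kn)).
apply: eq_bigr => i _.
(* Only [i <= k < n] contribute, so [bdiff] is evaluated at positive indices, where it is the true
   difference of the polynomial. *)
have [ik|ki] := leqP i k; last first.
  rewrite nth_default ?mul0r //; apply: leq_trans ki.
  apply: (leq_trans (size_poly_exp_leq _ _)).
  by rewrite -opprB size_polyN -polyC1 size_XsubC mul1n.
congr (_ * _); rewrite /bdiff.
case E: (n - i)%N => [|l].
  by move/eqP: E; rewrite subn_eq0 leqNgt (leq_ltn_trans ik kn).
by rewrite hornerD hornerN horner_comp !hornerE -natr1 addrK.
Qed.

(** Newton interpolation: the correction at [n] is a multiple of a product vanishing at all earlier
    nodes. *)
Lemma poly_interpolation (n : nat) f :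
  exists2 p : {poly R}, (size p <= n)%N & forall i, (i < n)%N -> p.[i%:R] = f i.
Proof.
elim: n => [|n [p sp hp]]; first by exists 0; rewrite ?size_poly0.
pose q : {poly R} := \prod_(i <- iota 0 n) ('X - (i%:R)%:P).
have q0 : q.[n%:R] != 0.
  rewrite horner_prod prodf_seq_neq0; apply/allP => i; rewrite mem_iota add0n.
  by rewrite !hornerE subr_eq0 eqr_nat => /ltn_eqF; rewrite eq_sym => ->.
exists (p + ((f n - p.[n%:R]) / q.[n%:R]) *: q).
  rewrite (leq_trans (size_polyD _ _)) // geq_max (leq_trans sp) //=.
  rewrite (leq_trans (size_scale_leq _ _)) // size_prod_XsubC.
  by rewrite size_iota.
move=> i; rewrite ltnS leq_eqVlt => /orP [/eqP ->|ltin].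
  by rewrite hornerD hornerZ divfK // addrC subrK.
rewrite hornerD hornerZ hp //.
suff -> : q.[i%:R] = 0 by rewrite mulr0 addr0.
apply/eqP; rewrite horner_prod prodf_seq_eq0; apply/hasP; exists i.
  by rewrite mem_iota.
by rewrite !hornerE subrr.
Qed.

(** The hypothesis is a linear recurrence of order [D] with leading coefficient 1. The polynomial
    interpolating the first [D] values satisfies it as well, so both sequences agree. *)
Lemma fps_mul_eventually0 f D :
  (forall n, (D <= n)%N ->
    fps_mul (fun i => ((1 - 'X) ^+ D : {poly R})`_i) f n = 0) ->
  exists p : {poly R}, forall t : nat, p.[t%:R] = f t.
Proof.
move=> h; have [p sp hp] := poly_interpolation D f.
exists p => t; have [n] := ubnP t; elim: n t => // n IH t.
rewrite ltnS => tn; have [/hp //|Dt] := ltnP t D.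
have := fps_mul_poly sp Dt; rewrite -[RHS](h t Dt) /fps_mul.
rewrite !big_ord_recl subn0.
have -> : ((1 - 'X) ^+ D : {poly R})`_(ord0 : 'I_t.+1) = 1.
  by rewrite -horner_coef0 horner_exp !hornerE subr0 expr1n.
rewrite !mul1r (eq_bigr (fun i : 'I_t =>
    ((1 - 'X) ^+ D : {poly R})`_(lift ord0 i) * f (t - lift ord0 i)%N)).
  by move/addIr.
move=> i _; rewrite IH // (leq_trans _ tn) // ltn_subrL /= .
exact: leq_trans (ltn_ord i).
Qed.

End FiniteDifferences.

(** * Polytopes as hulls of matrix rows, polyhedral sets, and homogenization *)

Section Polytopes.
Context {R : realType} {d : nat}.
Implicit Types (A K P : set 'rV[R]_d) (x y z : 'rV[R]_d).

Definition hull m (V : 'M[R]_(m, d)) : set 'rV[R]_d :=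
  [set x | exists l : 'rV[R]_m,
     [/\ forall i, 0 <= l 0 i, \sum_i l 0 i = 1 & x = l *m V]].

Lemma conv_hull_rows m (V : 'M[R]_(m, d)) (T : {set 'I_m}) :
  conv_hull [set row i V | i in [set` T]] =
  [set x | exists l : 'rV[R]_m,
     [/\ supp T l, forall i, 0 <= l 0 i, \sum_i l 0 i = 1 & x = l *m V]].
Proof.
apply/seteqP; split=> x /=.
  move=> [n [l [v [hv l0 l1 ->]]]].
  have /choice [f hf] : forall k, exists i, i \in T /\ row i V = v k.
    by move=> k; have [i iT iv] := hv k; exists i.
  exists (\row_i \sum_(k | f k == i) l k); split.
  - move=> i iT; rewrite mxE big1 // => k /eqP fk.
    by move: iT; rewrite -fk (proj1 (hf k)).
  - by move=> i; rewrite mxE sumr_ge0.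
  - rewrite -l1 [RHS](partition_big f xpredT) //=.
    by apply: eq_bigr => i _; rewrite mxE.
  rewrite mulmx_sum_row [LHS](partition_big f xpredT) //=.
  apply: eq_bigr => i _; rewrite mxE scaler_suml.
  by apply: eq_bigr => k /eqP <-; rewrite (proj2 (hf k)).
move=> [l [hl l0 l1 ->]].
have [i0 i0T] : exists i0, i0 \in T.
  apply: contrapT => hn; move: l1; rewrite big1 => [/eqP|i _].
    by rewrite eq_sym oner_eq0.
  by apply: hl; apply/negP => iT; apply: hn; exists i.
(* Indices outside [T] have weight 0, so their rows may be replaced by the row [i0], which does
   belong to the set. *)
exists m, (l 0), (fun i => row (if i \in T then i else i0) V); split=> //.
  by move=> i; exists (if i \in T then i else i0) => //=; case: ifP.
rewrite mulmx_sum_row; apply: eq_bigr => i _.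
by case: ifP => // /negbT iT; rewrite hl // !scale0r.
Qed.

Lemma conv_hull_hull m (V : 'M[R]_(m, d)) : conv_hull (range (fun i => row i V)) = hull V.
Proof.
have -> : range (fun i => row i V) = [set row i V | i in [set` finset.setT]].
  by apply/seteqP; split=> x [i _ <-]; exists i => //=; rewrite in_setT.
rewrite conv_hull_rows; apply/seteqP; split=> x [l].
  by move=> [_ ? ? ?]; exists l.
by move=> [? ? ?]; exists l; split=> // i; rewrite finset.in_setT.
Qed.

Lemma hull_polytope m (V : 'M[R]_(m, d)) : polytope (hull V).
Proof.
by exists (range (fun i => row i V)); [exact: finite_image|rewrite conv_hull_hull].
Qed.

Lemma polytope_hull P : polytope P -> exists m (V : 'M[R]_(m, d)), P = hull V.
Proof.
move=> [A /finite_seqP [s ->] ->].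
exists (size s), (\matrix_i s`_i); rewrite -conv_hull_hull; congr conv_hull.
apply/seteqP; split=> x /=.
  move=> xs; have hx : (index x s < size s)%N by rewrite index_mem.
  by exists (Ordinal hx) => //; rewrite rowK nth_index.
by move=> [i _ <-]; rewrite rowK mem_nth.
Qed.

Lemma hull_row m (V : 'M[R]_(m, d)) i : hull V (row i V).
Proof.
exists (delta_mx 0 i); split; last by rewrite -rowE.
  by move=> j; rewrite mxE ler0n.
rewrite (bigD1 i) //= mxE !eqxx big1 ?addr0 // => j ji.
by rewrite mxE (negbTE ji) andbF.
Qed.

Lemma row_row' m (V : 'M[R]_(m.+1, d)) i j : row j (row' i V) = row (lift i j) V.
Proof. by apply/rowP => k; rewrite !mxE. Qed.

Lemma hull_row' m (V : 'M[R]_(m.+1, d)) i :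
  hull (row' i V) (row i V) -> hull V = hull (row' i V).
Proof.
move=> [u [u0 u1 uV]]; apply/seteqP; split=> x [l [l0 l1 ->]].
  exists (l 0 i *: u + \row_j l 0 (lift i j)); split.
  - by move=> j; rewrite !mxE addr_ge0 // mulr_ge0.
  - rewrite (eq_bigr (fun j => l 0 i * u 0 j + l 0 (lift i j))).
      by rewrite big_split /= -mulr_sumr u1 mulr1 -l1 [RHS](bigD1_ord i).
    by move=> j _; rewrite !mxE.
  rewrite mulmxDl -scalemxAl -uV !mulmx_sum_row (bigD1_ord i) //=; congr (_ + _).
  by apply: eq_bigr => j _; rewrite mxE row_row'.
exists (\row_k if unlift i k is Some j then l 0 j else 0); split.
- by move=> k; rewrite mxE; case: unlift.
- rewrite (bigD1_ord i) //= mxE unlift_none add0r -l1.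
  by apply: eq_bigr => j _; rewrite mxE liftK.
rewrite !mulmx_sum_row [RHS](bigD1_ord i) //= mxE unlift_none scale0r add0r.
by apply: eq_bigr => j _; rewrite mxE liftK row_row'.
Qed.

Lemma simplex_vertex m (l : 'rV[R]_m) i : (forall j, 0 <= l 0 j) ->
  \sum_j l 0 j = 1 -> 1 <= l 0 i -> l = delta_mx 0 i.
Proof.
move=> l0 l1 li; move: l1; rewrite (bigD1 i) //= => l1.
have s0 : 0 <= \sum_(j | j != i) l 0 j by apply: sumr_ge0.
have /eqP : \sum_(j | j != i) l 0 j = 0 by lra.
rewrite psumr_eq0 // => /allP h; apply/rowP => j; rewrite mxE eqxx /=.
have [->|ji] := eqVneq j i; first by rewrite /=; lra.
by apply/eqP; move: (h j (mem_index_enum _)); rewrite ji.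
Qed.

(** A proper segment around row [i] writes this row as [g *m V]. Weight 1 at [i] would collapse both
    endpoints to the row itself; otherwise the equation can be solved for row [i] in terms of the
    other rows. *)
Lemma hull_nonvertex m (V : 'M[R]_(m.+1, d)) i :
  ~ vertex (hull V) (row i V) -> hull V = hull (row' i V).
Proof.
move=> nv; apply: hull_row'.
have /existsNP [y /existsNP [z /existsNP [s]]] :
    ~ forall y z s, hull V y -> hull V z -> 0 < s < 1 ->
      row i V = s *: y + (1 - s) *: z -> y = row i V /\ z = row i V.
  by move=> h; apply: nv; split=> //; exact: hull_row.
move=> /not_implyP [[a [a0 a1 ->]] /not_implyP [[b [b0 b1 ->]]]].
move=> /not_implyP [/andP [s0 s1] /not_implyP [e ne]].
pose g := s *: a + (1 - s) *: b.
have g0 j : 0 <= g 0 j.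
  by rewrite !mxE addr_ge0 // mulr_ge0 // ?subr_ge0 ltW.
have g1 : \sum_j g 0 j = 1.
  rewrite (eq_bigr (fun j => s * a 0 j + (1 - s) * b 0 j)).
    by rewrite big_split /= -!mulr_sumr a1 b1 !mulr1 addrC subrK.
  by move=> j _; rewrite !mxE.
have gV : row i V = g *m V by rewrite mulmxDl -!scalemxAl.
have le1 (c : 'rV[R]_m.+1) : (forall j, 0 <= c 0 j) -> \sum_j c 0 j = 1 -> c 0 i <= 1.
  by move=> c0 <-; rewrite (bigD1 i) //= lerDl sumr_ge0.
have gi : g 0 i < 1.
  rewrite ltNge; apply/negP => gi; apply: ne.
  have ai := le1 _ a0 a1; have bi := le1 _ b0 b1.
  move: gi; rewrite !mxE => gi.
  have a1' : 1 <= a 0 i.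
    rewrite leNgt; apply/negP => ?.
    have : s * a 0 i < s by rewrite gtr_pMr.
    have : (1 - s) * b 0 i <= 1 - s by rewrite ler_piMr // subr_ge0 ltW.
    lra.
  have b1' : 1 <= b 0 i.
    rewrite leNgt; apply/negP => ?.
    have : s * a 0 i <= s by rewrite ler_piMr // ltW.
    have : (1 - s) * b 0 i < 1 - s by rewrite gtr_pMr // subr_gt0.
    lra.
  by rewrite (simplex_vertex a0 a1 a1') (simplex_vertex b0 b1 b1') -rowE.
have gi' : 0 < 1 - g 0 i by rewrite subr_gt0.
exists ((1 - g 0 i)^-1 *: \row_j g 0 (lift i j)); split.
- by move=> j; rewrite mxE [X in _ * X]mxE mulr_ge0 // invr_ge0 ltW.
- rewrite (eq_bigr (fun j => (1 - g 0 i)^-1 * g 0 (lift i j))).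
    rewrite -mulr_sumr; have -> : \sum_j g 0 (lift i j) = 1 - g 0 i.
      by move: g1; rewrite (bigD1_ord i) //= => <-; rewrite addrAC subrr add0r.
    by rewrite mulVf // lt0r_neq0.
  by move=> j _; rewrite mxE [X in _ * X]mxE.
rewrite -scalemxAl; apply: (scalerI (lt0r_neq0 gi')).
rewrite scalerA divff ?lt0r_neq0 // scale1r scalerBl scale1r {1}gV.
rewrite !mulmx_sum_row (bigD1_ord i) //= addrAC subrr add0r.
by apply: eq_bigr => j _; rewrite mxE row_row'.
Qed.

(** Rows that are not vertices are discarded one at a time; the remaining ones are vertices, hence
    integral. *)
Lemma lattice_polytope_hull P : lattice_polytope P ->
  exists m (V : 'M[R]_(m, d)), P = hull V /\ forall i, int_vec (row i V).
Proof.
move=> [/polytope_hull [m [V ->]]]; elim: m V => [|m IH] V hV.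
  by exists 0, V; split=> // -[].
have [h|/existsNP [i ni]] := pselect (forall i, vertex (hull V) (row i V)).
  by exists m.+1, V; split=> // i; apply: hV.
by move: hV; rewrite (hull_nonvertex ni) => /IH.
Qed.

Lemma hull_bounded m (V : 'M[R]_(m, d)) j :
  exists b : R, forall x, hull V x -> `|x 0 j| <= b.
Proof.
exists (\sum_i `|V i j|) => x [l [l0 l1 ->]]; rewrite mxE.
apply: le_trans (ler_norm_sum _ _ _) _; apply: ler_sum => i _.
rewrite normrM ger0_norm // ler_piMl //.
by rewrite -l1 (bigD1 i) //= lerDl sumr_ge0.
Qed.

Lemma translateE y K x : translate y K x <-> K (x - y).
Proof.
split=> [[z Kz <-]|Kx]; first by rewrite addrK.
by exists (x - y) => //; rewrite subrK.
Qed.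

Lemma polytope_translate y P : polytope P -> polytope (translate y P).
Proof.
move=> [A fA ->]; exists (translate y A); first exact: finite_image.
apply/seteqP; split=> x.
  move=> /translateE [n [l [v [hv l0 l1 e]]]].
  exists n, l, (fun i => v i + y); split=> //.
    by move=> i; apply/translateE; rewrite addrK.
  rewrite (eq_bigr (fun i => l i *: v i + l i *: y)) => [|i _]; last by rewrite scalerDr.
  by rewrite big_split /= -scaler_suml l1 scale1r -e subrK.
move=> [n [l [v [hv l0 l1 ->]]]]; apply/translateE.
exists n, l, (fun i => v i - y); split=> //.
  by move=> i; apply/translateE; exact: hv.
rewrite [RHS](eq_bigr (fun i => l i *: v i - l i *: y)) => [|i _]; last by rewrite scalerBr.
by rewrite sumrB -scaler_suml l1 scale1r.
Qed.

Lemma polyhedral_translate y K : polyhedral K -> polyhedral (translate y K).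
Proof.
(* The sets with polyhedral translate by [y] form a ring containing the polytopes, hence contain the
   generated ring. *)
move=> hK; apply: (hK [set K | polyhedral (translate y K)]); split; last first.
  by move=> P hP; apply: sub_setring; apply: polytope_translate.
split=> /=.
- by rewrite /translate image_set0; exact: setring0.
- by move=> A B hA hB; rewrite /= /translate image_setU; exact: setringU.
move=> A B hA hB /=.
have -> : translate y (A `\` B) = translate y A `\` translate y B.
  apply/seteqP; split=> x.
    by move=> /translateE [Ax nBx]; split=> [|/translateE//]; apply/translateE.
  by move=> [/translateE Ax nBx]; apply/translateE; split=> // Bx; apply: nBx;
    apply/translateE.
exact: setringD.
Qed.

Lemma polyhedralD K1 K2 : polyhedral K1 -> polyhedral K2 -> polyhedral (K1 `\` K2).
Proof. exact: setringD. Qed.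

Lemma polyhedralU K1 K2 : polyhedral K1 -> polyhedral K2 -> polyhedral (K1 `|` K2).
Proof. exact: setringU. Qed.

Lemma polyhedral0 : polyhedral (set0 : set 'rV[R]_d).
Proof. exact: setring0. Qed.

Lemma polytope_polyhedral P : polytope P -> polyhedral P.
Proof. exact: sub_setring. Qed.

(** Generators [(v_i, 1)] of the cone over the polytope: affine relations become linear ones, and
    height [t] of the cone is the dilate by [t]. *)
Definition homogenize m (V : 'M[R]_(m, d)) : 'M[R]_(m, d + 1) :=
  row_mx V (const_mx 1).

Lemma mul_homogenize m (V : 'M[R]_(m, d)) (l : 'rV[R]_m) :
  l *m homogenize V = row_mx (l *m V) (\sum_i l 0 i)%:M.
Proof.
rewrite mul_mx_row; congr row_mx; apply/rowP => j.
rewrite ord1 !mxE mulr1n; apply: eq_bigr => i _; by rewrite mxE mulr1.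
Qed.

Lemma homogenize_pos m (V : 'M[R]_(m, d)) i :
  0 < (homogenize V *m col_mx 0 1%:M) i 0.
Proof. by rewrite mul_row_col mulmx0 add0r mulmx1 mxE. Qed.

Lemma homogenize_full m (V : 'M[R]_(m, d)) :
  full_dimensional (hull V) -> row_full (homogenize V).
Proof.
move=> fV; rewrite -sub1mx; apply/row_subP => k.
have h1 y : (row_mx y 1%:M <= homogenize V)%MS.
  have : aff_hull (hull V) y by rewrite fV.
  move=> [n [l [v [hv l1 ->]]]].
  have -> : row_mx (\sum_i l i *: v i) (1%:M : 'M[R]_1) =
      \sum_i l i *: row_mx (v i) 1%:M.
    have <- : (\sum_i l i)%:M = (1%:M : 'M[R]_1) by rewrite l1.
    rewrite [RHS](eq_bigr (fun i => row_mx (l i *: v i) (l i)%:M)).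
      apply/rowP => j; rewrite [RHS]summxE [LHS]mxE.
      case E: (fintype.split j) => [j'|j']; last rewrite ord1.
        by rewrite summxE; apply: eq_bigr => i _; rewrite [RHS]mxE E.
      rewrite mxE mulr1n; apply: eq_bigr => i _.
      by rewrite [RHS]mxE E ord1 mxE mulr1n.
    by move=> i _; rewrite l1 scale_row_mx scale_scalar_mx mulr1.
  apply: summx_sub => i _; apply: scalemx_sub.
  have [c [_ c1 ->]] := hv i; apply/submxP; exists c.
  by rewrite mul_homogenize c1.
set r := row k _; rewrite -[r]hsubmxK.
(* Every vector is a combination of vectors with last coordinate 1, which [h1] places in the row
   space. *)
have -> : row_mx (lsubmx r) (rsubmx r) =
   row_mx (lsubmx r) 1%:M - row_mx 0 1%:M + (rsubmx r 0 0) *: row_mx 0 1%:M.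
  rewrite opp_row_mx scale_row_mx !add_row_mx oppr0 scaler0 !addr0 subrr add0r.
  by rewrite scale_scalar_mx mulr1 -mx11_scalar.
by rewrite addmx_sub ?scalemx_sub // addmx_sub // eqmx_opp.
Qed.

Lemma dilate_hull m (V : 'M[R]_(m, d)) t x : (0 < t)%N ->
  dilate t (hull V) x <->
  exists l : 'rV[R]_m, [/\ forall i, 0 <= l 0 i, \sum_i l 0 i = t%:R & x = l *m V].
Proof.
move=> t0; have t0' : 0 < t%:R :> R by rewrite ltr0n.
split=> [[y [l [l0 l1 ->]] <-]|[l [l0 lt ->]]].
  exists (t%:R *: l); split; last by rewrite scalemxAl.
    by move=> i; rewrite mxE mulr_ge0.
  by rewrite -[RHS]mulr1 -l1 mulr_sumr; apply: eq_bigr => i _; rewrite mxE.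
exists (t%:R^-1 *: l *m V); last by rewrite -scalemxAl scalerA divff ?scale1r ?gt_eqF.
exists (t%:R^-1 *: l); split=> //.
  by move=> i; rewrite mxE mulr_ge0 // invr_ge0 ltW.
rewrite (eq_bigr (fun i => t%:R^-1 * l 0 i)) => [|i _]; last by rewrite mxE.
by rewrite -mulr_sumr lt mulVf // gt_eqF.
Qed.

End Polytopes.

(** * Levels of half-open cones and of their parallelepipeds *)

Section Cells.
Context {R : realType} {m d : nat}.
Implicit Types (V : 'M[R]_(m, d)) (T I B : {set 'I_m}) (l : 'rV[R]_m).

Lemma low_ge0 I i (x : R) : low I i x -> 0 <= x.
Proof. by rewrite /low; case: ifP => // _; exact: ltW. Qed.

Lemma low_add1 I i (x : R) : low I i x -> low I i (x + 1).
Proof. by rewrite /low; case: ifP => _ ?; lra. Qed.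

Lemma low_lt0 I i (x : R) : x < 0 -> ~~ low I i x.
Proof. by move=> x0; apply/negP => /low_ge0; lra. Qed.

Lemma halfopen_ge0 I T l : halfopen I T l -> forall i, 0 <= l 0 i.
Proof.
by move=> [hl h] i; have [/h/low_ge0//|/hl ->] := boolP (i \in T).
Qed.

(* Level [t] of the half-open cone over [T]; the coordinates in [B] are bounded
   above so that the unit steps in the directions of [B] tile the cone.  For
   [B = T] this is a level of the fundamental parallelepiped. *)
Definition cell V T I B (t : nat) : set 'rV[R]_d :=
  [set x | exists l, [/\ halfopen I T l, \sum_i l 0 i = t%:R,
     forall i, i \in B -> ~~ low I i (l 0 i - 1) & x = l *m V]].

Lemma cell_sub V T I B t : cell V T I B t `<=` cell V T I finset.set0 t.
Proof.
by move=> x [l [hl lt lB ->]]; exists l; split=> // i; rewrite finset.in_set0.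
Qed.

Lemma cell_level0 V T I B : cell V T I B 0 `<=` [set 0].
Proof.
move=> x [l [hl lt lB ->]]; suff -> : l = 0 by rewrite mul0mx.
move/eqP: lt; rewrite psumr_eq0 => [/allP h|i _]; last exact: halfopen_ge0 hl i.
by apply/rowP => i; rewrite mxE; apply/eqP; apply: h (mem_index_enum _).
Qed.

(** At level 0 all coordinates are 0, so every upper bound holds. *)
Lemma cell_bounded0 V T I B i : cell V T I (i |: B) 0 = cell V T I B 0.
Proof.
apply/seteqP; split=> x [l [hl lt lB ->]]; exists l; split=> // j jB.
  by apply: lB; rewrite !inE jB orbT.
have l0 := halfopen_ge0 hl.
move: lB jB; rewrite !inE => lB /orP [/eqP ->|/lB//].
apply: low_lt0; move/eqP: lt; rewrite psumr_eq0 // => /allP /(_ i).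
by move=> /(_ (mem_index_enum _)) /eqP ->; rewrite sub0r oppr_lt0.
Qed.

(** Bounded coordinates lie in [(0, 1]] for indices in [I] and in [[0, 1)] otherwise; as the second
    kind occurs, their sum stays below [#|T|]. *)
Lemma cell_full V T I t : T != finset.set0 -> ~~ (T \subset I) ->
  (#|T| <= t)%N -> cell V T I T t = set0.
Proof.
move=> T0 /fintype.subsetPn [i iT iI] tT; apply/seteqP; split=> // x.
move=> [l [[hl _] lt lB _]].
have : \sum_j l 0 j < t%:R; last by rewrite lt ltxx.
apply: (lt_le_trans (y := #|T|%:R)); last by rewrite ler_nat.
have l1 j : j \in T -> l 0 j <= 1.
  by move/lB; rewrite /low; case: ifP => _; rewrite -?leNgt -?ltNge; lra.
have li : l 0 i < 1.
  by have := lB i iT; rewrite /low (negbTE iI) -ltNge; lra.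
have -> : \sum_j l 0 j = \sum_(j in T) l 0 j.
  rewrite [RHS]big_mkcond; apply: eq_bigr => j _.
  by case: ifP => // /negbT /hl.
rewrite -sum1_card natr_sum (bigD1 i) //= [ltRHS](bigD1 i) //=.
by apply: ltr_leD => //; apply: ler_sum => j /andP [/l1].
Qed.

Section Independent.
Variables (V : 'M[R]_(m, d)) (T : {set 'I_m}).
Hypothesis iT : indep (homogenize V) T.

Lemma cell_inj l l' : supp T l -> supp T l' ->
  \sum_i l 0 i = \sum_i l' 0 i -> l *m V = l' *m V -> l = l'.
Proof.
move=> hl hl' es eV; apply: (indep_inj iT) => //.
by rewrite !mul_homogenize es eV.
Qed.

Lemma cell_step I B i t : i \in T -> i \notin B ->
  translate (row i V) (cell V T I B t) `<=` cell V T I B t.+1.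
Proof.
move=> iiT iB x /translateE [l [[hl low_l] lt lB e]].
exists (l + delta_mx 0 i); split.
- split; first by apply: suppD => //; apply: supp_delta.
  move=> j jT; rewrite !mxE eqxx; have [->|_] := eqVneq j i.
    by apply: low_add1; apply: low_l.
  by rewrite addr0 low_l.
- rewrite (eq_bigr (fun j => l 0 j + (j == i)%:R)) => [|j _]; last by rewrite !mxE.
  rewrite big_split /= lt (bigD1 i) //= eqxx big1 ?addr0 ?natr1 // => j.
  by move/negbTE ->.
- move=> j jB; rewrite !mxE eqxx.
  have [ji|_] := eqVneq j i; first by rewrite -ji jB in iB.
  by rewrite addr0 lB.
by rewrite mulmxDl -e -rowE subrK.
Qed.

(** The upper bound on coordinate [i] fails exactly when this coordinate can be lowered by 1 inside
    the cone, that is, when the point comes from the previous level by the step [row i V].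
    Uniqueness of coordinates makes the two cases exclusive. *)
Lemma cell_bounded I B i t : i \in T -> i \notin B ->
  cell V T I (i |: B) t.+1 =
  cell V T I B t.+1 `\` translate (row i V) (cell V T I B t).
Proof.
move=> iiT iB; apply/seteqP; split=> x.
  move=> [l [[hl low_l] lt lB ->]]; split.
    exists l; split=> // j jB.
    by apply: lB; rewrite !inE jB orbT.
  move=> /translateE [l' [[hl' low_l'] lt' lB' e]].
  have : l = l' + delta_mx 0 i.
    apply: cell_inj => //.
    - by apply: suppD => //; apply: supp_delta.
    - rewrite lt (eq_bigr (fun j => l' 0 j + (j == i)%:R)).
        rewrite big_split /= lt' (bigD1 i) //= eqxx big1 ?addr0 ?natr1 // => j.
        by move/negbTE ->.
      by move=> j _; rewrite !mxE.
    by rewrite mulmxDl -e -rowE subrK.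
  move=> el; have := lB i; rewrite !inE eqxx => /(_ isT).
  by rewrite el !mxE !eqxx addrK low_l'.
move=> [[l [[hl low_l] lt lB ->]] nx]; exists l; split=> //.
move=> j; rewrite !inE => /orP [/eqP ->|/lB//].
apply/negP => li; apply: nx; apply/translateE.
exists (l - delta_mx 0 i); split.
- split; first by apply: suppD => //; apply: suppN; apply: supp_delta.
  move=> k kT; rewrite !mxE eqxx; have [->//|_] := eqVneq k i.
  by rewrite subr0 low_l.
- rewrite (eq_bigr (fun j => l 0 j - (j == i)%:R)) => [|k _]; last by rewrite !mxE.
  rewrite sumrB lt (bigD1 i) //= eqxx big1 ?addr0 => [|k /negbTE -> //].
  by rewrite -natr1 addrK.
- move=> k kB; rewrite !mxE eqxx.
  have [ki|_] := eqVneq k i; first by rewrite -ki kB in iB.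
  by rewrite subr0 lB.
by rewrite mulmxBl -rowE.
Qed.

(** The removed set is the facet on which coordinate [i] vanishes. *)
Lemma cell_open I i t : i \in T ->
  cell V T (i |: I) finset.set0 t =
  cell V T I finset.set0 t `\` cell V (T :\ i) I finset.set0 t.
Proof.
move=> iiT; apply/seteqP; split=> x.
  move=> [l [[hl low_l] lt lB ->]]; split.
    exists l; split=> //; last by move=> j; rewrite finset.in_set0.
    split=> // j /low_l; rewrite /low !inE; case: eqP => //= _.
    by case: ifP => // _ /ltW.
  move=> [l' [[hl' _] lt' _ e]].
  have el : l = l'.
    apply: cell_inj; rewrite ?lt' // => j jT; apply: hl'.
    by rewrite !inE negb_and jT orbT.
  have := low_l i iiT; rewrite el hl' ?inE ?eqxx //.
  by rewrite /low !inE eqxx /= ltxx.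
move=> [[l [[hl low_l] lt lB ->]] nx]; exists l; split=> //; last first.
  by move=> j; rewrite finset.in_set0.
split=> // j jT; have := low_l j jT; rewrite /low !inE.
have [->|_] //= := eqVneq j i => li.
have l0 : 0 <= l 0 i by apply: (@low_ge0 I i).
rewrite lt_neqAle l0 andbT; apply/eqP => li0; apply: nx.
exists l; split=> //; split.
  move=> k; rewrite !inE negb_and negbK => /orP [/eqP -> //|/hl //].
by move=> k; rewrite !inE => /andP [_ /low_l].
Qed.

End Independent.

Lemma polytope1 (x : 'rV[R]_d) : polytope [set x].
Proof.
have -> : [set x] = hull x.
  apply/seteqP; split=> y /=.
    move=> ->; exists 1%:M; rewrite mul1mx; split=> //.
      by move=> i; rewrite ord1 mxE.
    by rewrite big_ord1 mxE.
  move=> [l [_ l1 ->]]; rewrite big_ord1 in l1.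
  by rewrite [l]mx11_scalar l1 mul1mx.
exact: hull_polytope.
Qed.

Lemma polytope_cell V T t : polytope (cell V T finset.set0 finset.set0 t).
Proof.
case: t => [|t].
  (* Level 0 is treated apart, as it cannot be rescaled to weights of sum 1. *)
  have -> : cell V T finset.set0 finset.set0 0 = [set 0]; last exact: polytope1.
  apply/seteqP; split; first exact: cell_level0.
  move=> x ->; exists 0; rewrite mul0mx; split=> //.
  - by split=> i _; rewrite mxE // /low finset.in_set0.
  - by rewrite big1 // => i _; rewrite mxE.
  by move=> i; rewrite finset.in_set0.
exists [set row i (t.+1%:R *: V) | i in [set` T]]; first exact: finite_image.
have t0 : 0 < t.+1%:R :> R by rewrite ltr0n.
rewrite conv_hull_rows; apply/seteqP; split=> x [l].
  move=> [hl lt _ ->]; exists (t.+1%:R^-1 *: l); split.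
  - exact: suppZ (proj1 hl).
  - by move=> i; rewrite mxE mulr_ge0 ?invr_ge0 ?(ltW t0) //; exact: halfopen_ge0 hl i.
  - rewrite (eq_bigr (fun i => t.+1%:R^-1 * l 0 i)) => [|i _]; last by rewrite mxE.
    by rewrite -mulr_sumr lt mulVf // gt_eqF.
  by rewrite -scalemxAl -scalemxAr scalerA mulVf ?scale1r // gt_eqF.
move=> [hl l0 l1 ->]; exists (t.+1%:R *: l); split.
- split; first exact: suppZ.
  by move=> i _; rewrite /low finset.in_set0 mxE mulr_ge0 // ltW.
- rewrite (eq_bigr (fun i => t.+1%:R * l 0 i)) => [|i _]; last by rewrite mxE.
  by rewrite -mulr_sumr l1 mulr1.
- by move=> i; rewrite finset.in_set0.
by rewrite -scalemxAl -scalemxAr.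
Qed.

(** Facets are removed one at a time from a closed simplex; an index of [I] outside [T] changes
    nothing. *)
Lemma polyhedral_cell_open V T I t : indep (homogenize V) T ->
  polyhedral (cell V T I finset.set0 t).
Proof.
have [n] := ubnP #|I|; elim: n I T => // n IH I T.
have [-> _ _|[i iI]] := set_0Vmem I.
  by apply: polytope_polyhedral; apply: polytope_cell.
rewrite ltnS => In iT.
have cI : (#|I :\ i| < n)%N by rewrite [#|I|](cardsD1 i) iI in In.
rewrite -(finset.setD1K iI); have [iiT|niT] := boolP (i \in T).
  rewrite cell_open //; apply: polyhedralD; apply: IH => //.
  exact: indep_sub (finset.subD1set _ _) iT.
have -> : cell V T (i |: I :\ i) finset.set0 t = cell V T (I :\ i) finset.set0 t.
  have lowE j (y : R) : j \in T -> low (i |: I :\ i) j y = low (I :\ i) j y.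
    move=> jT; rewrite /low !inE; case: eqP => // ji.
    by rewrite -ji jT in niT.
  apply/seteqP; split=> x [l [[hl low_l] lt lB ->]]; exists l.
    split=> //; last by move=> j; rewrite finset.in_set0.
    by split=> // j jT; rewrite -lowE // low_l.
  split=> //; last by move=> j; rewrite finset.in_set0.
  by split=> // j jT; rewrite lowE // low_l.
exact: IH.
Qed.

Lemma polyhedral_cell V T I B t : indep (homogenize V) T -> B \subset T ->
  polyhedral (cell V T I B t).
Proof.
move=> iT; have [n] := ubnP #|B|; elim: n B t => // n IH B t.
have [-> _ _|[i iB]] := set_0Vmem B; first exact: polyhedral_cell_open.
rewrite ltnS => Bn BT.
have cB : (#|B :\ i| < n)%N by rewrite [#|B|](cardsD1 i) iB in Bn.
have sB : B :\ i \subset T by apply: fintype.subset_trans BT; apply: finset.subD1set.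
rewrite -(finset.setD1K iB); case: t => [|t].
  by rewrite cell_bounded0; apply: IH.
rewrite cell_bounded //; last by rewrite !inE eqxx.
  by apply: polyhedralD; [|apply: polyhedral_translate]; apply: IH.
exact: (fintype.subsetP BT).
Qed.

End Cells.

(** * Total value of a valuation over the lattice *)

Section Mass.
Context {R : realType} {d : nat} (nu : set 'rV[R]_d -> 'rV[R]_d -> R).

Definition mass (K : set 'rV[R]_d) : \bar R :=
  (\esum_(x in int_vec) (nu K x)%:E)%E.

Lemma mass_translate K y : translation_invariant nu -> polyhedral K ->
  int_vec y -> mass (translate y K) = mass K.
Proof.
move=> ht hK hy; rewrite /mass (reindex_esum int_vec int_vec (fun x => x + y)).
  by apply: eq_esum => x _; rewrite ht.
split.
- by move=> x hx j; rewrite mxE rpredD.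
- by move=> x z _ _ /addIr.
move=> x hx; exists (x - y); last by rewrite subrK.
by move=> j; rewrite !mxE rpredB.
Qed.

Lemma lattice_sum1 P : lattice_sum nu P 1 = mass P.
Proof.
rewrite /lattice_sum; suff -> : dilate 1 P = P by [].
apply/seteqP; split=> y; first by move=> [z Pz <-]; rewrite scale1r.
by move=> Py; exists y => //; rewrite scale1r.
Qed.

End Mass.

(** * Vanishing of the valuation on the empty set *)

Section EmptySet.
Context {R : realType} {d : nat}.

(* If [P] and [P + y] are disjoint, then [nu P x + nu (P + y) x >= nu set0 x],
   a constant, which is summable over the lattice only if it is [0]. *)
Lemma valuation_set0 (nu : set 'rV[R]_d.+1 -> 'rV[R]_d.+1 -> R) P x :
  valuation nu -> translation_invariant nu -> nonnegative_valuation nu ->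
  polytope P -> (mass nu P < +oo)%E -> nu set0 x = 0.
Proof.
move=> hv ht h0 pP fin.
have cst y : nu set0 y = nu set0 0.
  rewrite -(ht set0 0 y); last exact: polyhedral0.
  by rewrite /translate image_set0 add0r.
rewrite cst; set c := nu set0 0.
have c0 : 0 <= c by apply: h0; exact: polyhedral0.
apply/eqP; rewrite eq_le c0 andbT leNgt; apply/negP => cpos.
have [m [V PV]] := polytope_hull pP.
have [b hb] := hull_bounded V 0.
(* On [P] the first coordinate stays in an interval of length [2 * b]; an integer shift by more than
   that separates [P] from its translate. *)
pose N := (Num.bound (2 * b)).
pose e (k : nat) : 'rV[R]_d.+1 := k%:R *: delta_mx 0 0.
have e_int k : int_vec (e k) by move=> j; rewrite !mxE eqxx rpredM ?rpred_nat.
have pP' := polytope_translate (e N) pP.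
have [hP hP'] := (polytope_polyhedral pP, polytope_polyhedral pP').
have disj : P `&` translate (e N) P = set0.
  apply/seteqP; split=> // y [Py /translateE Py'].
  rewrite PV in Py Py'; have := hb _ Py; have := hb _ Py'.
  rewrite !mxE !eqxx mulr1 !ler_norml => /andP [h1 h2] /andP [h3 h4].
  have b0 : 0 <= 2 * b by have := le_trans h3 h4; lra.
  have := archi_boundP b0; rewrite -/N => h5; exfalso.
  by clear fin; lra.
have fin' : (mass nu (translate (e N) P) < +oo)%E by rewrite mass_translate.
have big : (\esum_(y in @int_vec R d.+1) c%:E <=
    \esum_(y in int_vec) ((nu P y)%:E + (nu (translate (e N) P) y)%:E))%E.
  apply: le_esum => y _; rewrite -EFinD lee_fin.
  have := hv P (translate (e N) P) y hP hP'; rewrite disj cst -/c => hU.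
  have : 0 <= nu (P `|` translate (e N) P) y by apply: h0; apply: polyhedralU.
  by rewrite hU subr_ge0.
rewrite esumD in big; last 2 first.
- by move=> y _; rewrite lee_fin h0.
- by move=> y _; rewrite lee_fin h0.
have fin2 := lte_add_pinfty fin fin'.
have fin3 := le_lt_trans big fin2.
set s := (\esum_(y in _) c%:E)%E in fin3.
have s0 : (0 <= s)%E by apply: esum_ge0 => y _; rewrite lee_fin.
have sfin : s \is a fin_num by rewrite ge0_fin_numE.
(* The constant is summed over [n] distinct lattice points on an axis, for every [n], against the
   Archimedean property. *)
have sn n : n%:R * c <= fine s.
  rewrite -lee_fin fineK //; apply: esum_ge.
  have einj : set_inj `I_n e.
    move=> i j _ _ /rowP /(_ 0); rewrite !mxE eqxx !mulr1 => /eqP.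
    by rewrite eqr_nat => /eqP.
  exists (e @` `I_n).
    by split; [apply: finite_image; exact: finite_II|move=> _ [k _ <-]].
  rewrite fsbig_image //= -(fsbig_ord _ n (fun _ => c%:E)) sumEFin lee_fin.
  by rewrite sumr_const card_ord mulr_natl.
have := archi_boundP (divr_ge0 (fine_ge0 s0) c0).
by rewrite ltr_pdivrMr // ltNge sn.
Qed.

End EmptySet.

(** * Additivity of the mass and generating functions of half-open cones *)

Section Measure.
Context {R : realType} {d : nat} (nu : set 'rV[R]_d -> 'rV[R]_d -> R).
Hypotheses (nu_val : valuation nu) (nu_tinv : translation_invariant nu).
Hypotheses (nu_ge0 : nonnegative_valuation nu) (nu0 : forall x, nu set0 x = 0).

Local Notation mass := (mass nu).

Lemma mass_ge0 K : polyhedral K -> (0 <= mass K)%E.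
Proof. by move=> hK; apply: esum_ge0 => x _; rewrite lee_fin nu_ge0. Qed.

Lemma mass_set0 : mass set0 = 0%E.
Proof. by apply: esum1 => x _; rewrite nu0. Qed.

(** Since [nu] vanishes on the empty set, inclusion-exclusion becomes additivity, and nonnegativity
    lets the sums be split. *)
Lemma massU K L : polyhedral K -> polyhedral L -> K `&` L = set0 ->
  mass (K `|` L) = (mass K + mass L)%E.
Proof.
move=> hK hL KL; rewrite /mass -esumD; last 2 first.
- by move=> x _; rewrite lee_fin nu_ge0.
- by move=> x _; rewrite lee_fin nu_ge0.
by apply: eq_esum => x _; rewrite -EFinD nu_val // KL nu0 subr0.
Qed.

Lemma massD K L : polyhedral K -> polyhedral L -> L `<=` K ->
  mass K = (mass L + mass (K `\` L))%E.
Proof.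
move=> hK hL LK; rewrite -massU //.
- by rewrite setDUK.
- exact: polyhedralD.
by rewrite setDIK.
Qed.

Lemma le_mass K L : polyhedral K -> polyhedral L -> L `<=` K ->
  (mass L <= mass K)%E.
Proof.
by move=> hK hL LK; rewrite (massD hK hL LK) leeDl // mass_ge0 //; exact: polyhedralD.
Qed.

Lemma mass_bigcup (J : eqType) (s : seq J) (F : J -> set 'rV[R]_d) : uniq s ->
  (forall j, j \in s -> polyhedral (F j)) ->
  (forall i j x, i \in s -> j \in s -> F i x -> F j x -> i = j) ->
  polyhedral [set x | exists2 j, j \in s & F j x] /\
  mass [set x | exists2 j, j \in s & F j x] = (\sum_(j <- s) mass (F j))%E.
Proof.
elim: s => [_ _ _|j s IH /= /andP [js us] hF dF].
  have -> : [set x | exists2 j, j \in [::] & F j x] = set0.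
    by apply/seteqP; split=> // x [].
  by rewrite big_nil mass_set0; split=> //; exact: polyhedral0.
have [||hs ms] := IH us.
- by move=> i iis; apply: hF; rewrite inE iis orbT.
- by move=> i k x iis ks; apply: dF; rewrite inE ?iis ?ks orbT.
have -> : [set x | exists2 i, i \in j :: s & F i x] =
    F j `|` [set x | exists2 i, i \in s & F i x].
  apply/seteqP; split=> x /=.
    by move=> [i]; rewrite inE => /orP [/eqP ->|iis] Fi; [left|right; exists i].
  by move=> [Fj|[i iis Fi]]; [exists j; rewrite ?inE ?eqxx|exists i; rewrite ?inE ?iis ?orbT].
have hj : polyhedral (F j) by apply: hF; rewrite inE eqxx.
split; first exact: polyhedralU.
rewrite massU // ?ms ?big_cons //.
apply/seteqP; split=> // x [Fj [i iis Fi]].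
have := dF j i x; rewrite !inE eqxx iis orbT => /(_ isT isT Fj Fi) e.
by rewrite e iis in js.
Qed.

Section Cone.
Variables (m : nat) (V : 'M[R]_(m, d)) (T I : {set 'I_m}).
Hypothesis V_int : forall i, int_vec (row i V).
Hypothesis iT : indep (homogenize V) T.
Hypothesis fin : forall t, (mass (cell V T I finset.set0 t) < +oo)%E.

Implicit Types B : {set 'I_m}.

Definition cell_mass B t : R := fine (mass (cell V T I B t)).

Lemma cell_mass_fin B t : B \subset T -> mass (cell V T I B t) \is a fin_num.
Proof.
move=> BT; rewrite ge0_fin_numE; last by apply: mass_ge0; apply: polyhedral_cell.
apply: le_lt_trans (fin t); apply: le_mass; last exact: cell_sub.
  exact: polyhedral_cell_open.
exact: polyhedral_cell.
Qed.

Lemma cell_mass_ge0 B t : B \subset T -> 0 <= cell_mass B t.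
Proof. by move=> BT; apply: fine_ge0; apply: mass_ge0; apply: polyhedral_cell. Qed.

(** By [cell_bounded], level [t + 1] splits into the bounded cell and a lattice translate of level
    [t], whose mass is unchanged. *)
Lemma cell_mass_bounded B i : i \in T -> i \notin B -> B \subset T ->
  cell_mass (i |: B) = bdiff (cell_mass B).
Proof.
move=> iiT iB BT; apply/funext => -[|t]; rewrite /bdiff.
  by rewrite /cell_mass cell_bounded0 subr0.
have hc t' : polyhedral (cell V T I B t') by exact: polyhedral_cell.
have e : mass (cell V T I B t.+1) = (mass (cell V T I B t) +
    mass (cell V T I (i |: B) t.+1))%E.
  rewrite cell_bounded // -[X in (X + _)%E](mass_translate nu_tinv (hc t) (V_int i)).
  by apply: massD => //; [exact: polyhedral_translate|exact: cell_step].
have iBT : i |: B \subset T by rewrite finset.subUset finset.sub1set iiT.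
by rewrite /cell_mass e fineD ?cell_mass_fin // addrC addKr.
Qed.

Lemma fps_cell_mass B n : B \subset T ->
  fps_mul (fun i => ((1 - 'X) ^+ #|B| : {poly R})`_i)
    (cell_mass finset.set0) n = cell_mass B n.
Proof.
(* For the induction, [A] collects the directions not yet bounded, and [p] absorbs the factors
   [1 - 'X] still to be used. *)
suff h k : forall (p : {poly R}) (A : {set 'I_m}), #|A| = k -> A \subset B -> B \subset T ->
    fps_mul (fun i => (p * (1 - 'X) ^+ k)`_i) (cell_mass (B :\: A)) n =
    fps_mul (fun i => p`_i) (cell_mass B) n.
  move=> BT; have := h _ 1 B erefl (subxx _) BT.
  by rewrite mul1r finset.setDv fps_mul1.
elim: k => [|k IH] p A cA AB BT.
  by move/eqP: cA; rewrite cards_eq0 => /eqP ->; rewrite finset.setD0 mulr1.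
have [i iA] : exists i, i \in A by apply/set0Pn; rewrite -card_gt0 cA.
have iB := fintype.subsetP AB i iA.
rewrite exprSr mulrA fps_mul_bdiff -(@cell_mass_bounded _ i).
- have -> : i |: B :\: A = B :\: (A :\ i).
    apply/setP => j; rewrite !inE negb_and negbK.
    by case: eqP => [->|//] /=; rewrite iB.
  apply: IH => //; first by move: cA; rewrite (cardsD1 i) iA => -[].
  by apply: fintype.subset_trans AB; exact: finset.subD1set.
- exact: (fintype.subsetP BT).
- by rewrite !inE iA.
by apply: fintype.subset_trans BT; exact: finset.subsetDl.
Qed.

End Cone.

End Measure.

(** * Dimension zero, and assembly of the cells of the triangulation *)

Lemma theorem1p3_dim0 (R : realType)
    (nu : set 'rV[R]_0 -> 'rV[R]_0 -> R) (P : set 'rV[R]_0) :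
  nonnegative_valuation nu -> lattice_polytope P -> full_dimensional P ->
  exists N a : {poly R},
    [/\ forall t : nat, (0 < t)%N -> lattice_sum nu P t = (N.[t%:R])%:E,
        (size a <= 1)%N,
        forall n : nat,
          fps_mul (fun i => ((1 - 'X) ^+ 1 : {poly R})`_i)
                  (fun t => N.[t%:R]) n = a`_n
      & forall j : nat, (j <= 0)%N -> 0 <= a`_j].
Proof.
move=> nu_ge0 [hP _] dP.
have P0 : P 0.
  have : aff_hull P 0 by rewrite dP.
  move=> [n [l [v [hv l1 _]]]]; case: n => [|n] in l v hv l1 *.
    by move/eqP: l1; rewrite big_ord0 eq_sym oner_eq0.
  by have := hv ord0; rewrite thinmx0.
have tP t : dilate t P = P.
  by apply/seteqP; split=> x _; [rewrite thinmx0|exists 0 => //; rewrite !thinmx0].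
have c0 : 0 <= nu P 0 by apply: nu_ge0; apply: polytope_polyhedral.
exists (nu P 0)%:P, (nu P 0)%:P; split.
- move=> t _; rewrite hornerC /lattice_sum tP.
  have -> : int_vec = [set (0 : 'rV[R]_0)].
    by apply/seteqP; split=> x _; [rewrite /= thinmx0|move=> []].
  by rewrite esum_set1 // lee_fin.
- exact: size_polyC_leq1.
- move=> n; rewrite -[_ ^+ 1]mul1r fps_mul_bdiff fps_mul1 /bdiff coefC.
  by case: n => [|n]; rewrite !hornerC ?subr0 ?subrr.
by move=> [|//] _; rewrite coefC.
Qed.

(** The covering of the cone is cut at height [t]: the last homogeneous coordinate forces equal sums
    of weights. *)
Lemma dilate_cells (R : realType) (m d : nat) (V : 'M[R]_(m, d))
    (tri : {set {set 'I_m}}) (I : {set 'I_m} -> {set 'I_m}) (t : nat) :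
  (0 < t)%N ->
  (forall c : 'rV[R]_m, (forall i, 0 <= c 0 i) -> exists T c',
     [/\ T \in tri, halfopen (I T) T c'
       & c' *m homogenize V = c *m homogenize V]) ->
  dilate t (hull V) =
  [set x | exists2 T, T \in enum tri & cell V T (I T) finset.set0 t x].
Proof.
move=> t0 htri; apply/seteqP; split=> x.
  move=> /(dilate_hull _ _ t0) [l [l0 lt ->]].
  have [T [c [Ttri hc]]] := htri l l0.
  rewrite !mul_homogenize => /eq_row_mx [eV /matrixP /(_ 0 0)].
  rewrite !mxE !mulr1n => es.
  exists T; first by rewrite mem_enum.
  exists c; split=> //; first by rewrite es.
  by move=> i; rewrite finset.in_set0.
move=> [T _ [l [hl lt _ ->]]]; apply/(dilate_hull _ _ t0).
by exists l; split=> //; exact: halfopen_ge0 hl.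
Qed.

Theorem theorem1p3 (R : realType) (d : nat)
    (nu : set 'rV[R]_d -> 'rV[R]_d -> R) (P : set 'rV[R]_d)
    (nu_val : valuation nu)
    (nu_tinv : translation_invariant nu)
    (nu_ge0 : nonnegative_valuation nu)
    (P_lattice : lattice_polytope P)
    (P_dim : full_dimensional P)
    (sum_fin : forall t : nat, (0 < t)%N -> (lattice_sum nu P t < +oo)%E) :
  exists N a : {poly R},
    [/\ forall t : nat, (0 < t)%N -> lattice_sum nu P t = (N.[t%:R])%:E,
        (size a <= d.+1)%N,
        forall n : nat,
          fps_mul (fun i => ((1 - 'X) ^+ d.+1 : {poly R})`_i)
                  (fun t => N.[t%:R]) n = a`_n
      & forall j : nat, (j <= d)%N -> 0 <= a`_j].
Proof.
case: d => [|d] in nu P nu_val nu_tinv nu_ge0 P_lattice P_dim sum_fin *.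
  exact: theorem1p3_dim0.
have P_polytope := proj1 P_lattice.
have fin1 : (mass nu P < +oo)%E by rewrite -lattice_sum1; exact: sum_fin.
have nu0 x : nu set0 x = 0 by exact: valuation_set0 P_polytope fin1.
have [m [V [PV V_int]]] := lattice_polytope_hull P_lattice; subst P.
have [tri [I [tri_basis tri_I tri_cover tri_disj]]] :=
  halfopen_triangulation (homogenize_pos V).
have fV := homogenize_full P_dim.
have cardT T : T \in tri -> #|T| = d.+2.
  by move=> /tri_basis /(card_basis fV) ->; rewrite addn1.
have T0 T : T \in tri -> T != finset.set0.
  by move=> /cardT cT; rewrite -card_gt0 cT.
have iT T : T \in tri -> indep (homogenize V) T by move=> /tri_basis [].
have sumE t : (0 < t)%N -> lattice_sum nu (hull V) t =
    (\sum_(T <- enum tri) mass nu (cell V T (I T) finset.set0 t))%E /\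
    polyhedral (dilate t (hull V)).
  move=> t0; rewrite /lattice_sum -/(mass nu _) (dilate_cells t0 tri_cover).
  have [||h1 h2] := @mass_bigcup _ _ _ nu_val nu_ge0 nu0 _ (enum tri)
    (fun T => cell V T (I T) finset.set0 t) (enum_uniq _).
  - by move=> T; rewrite mem_enum => /iT ?; exact: polyhedral_cell_open.
  - move=> T S x; rewrite !mem_enum => hT hS [l [hl lt _ ->]] [l' [hl' lt' _ e]].
    apply: (tri_disj _ _ _ _ hT hS hl hl').
    by rewrite !mul_homogenize e lt lt'.
  by rewrite h2.
have fin T t : T \in tri ->
    (mass nu (cell V T (I T) finset.set0 t) < +oo)%E.
  (* Level 0 is outside the scope of [sum_fin]; a translate of it by a row of [V] lies in the
     polytope itself. Positive levels lie in the dilates. *)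
  move=> hT; case: t => [|t].
    have /set0Pn [i iiT] := T0 T hT.
    have hP := polytope_polyhedral P_polytope.
    have hc := polyhedral_cell_open (I T) 0 (iT T hT).
    rewrite -(mass_translate nu_tinv hc (V_int i)); apply: le_lt_trans fin1.
    apply: le_mass => //; first exact: polyhedral_translate.
    move=> x /translateE /cell_level0 /eqP; rewrite subr_eq0 => /eqP ->.
    exact: hull_row.
  have [_ hP] := sumE t.+1 isT; apply: le_lt_trans (sum_fin t.+1 isT).
  apply: le_mass => //; first by apply: polyhedral_cell_open; exact: iT.
  rewrite (dilate_cells _ tri_cover) // => x hx.
  by exists T => //; rewrite mem_enum.
(* [L] equals the lattice sum for [t > 0], and its value at 0 comes from the apexes of the half-open
   cones. It is polynomial at 0 too, because [h], the candidate numerator, vanishes from [d.+2] on;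
   so [L 0] is the required [N.[0]]. *)
pose L t := \sum_(T <- enum tri) cell_mass nu V T (I T) finset.set0 t.
pose h n := \sum_(T <- enum tri) cell_mass nu V T (I T) T n.
have fpsL n : fps_mul (fun i => ((1 - 'X) ^+ d.+2 : {poly R})`_i) L n = h n.
  rewrite /fps_mul /L /h.
  under eq_bigr do rewrite mulr_sumr.
  rewrite exchange_big /= big_seq [RHS]big_seq; apply: eq_bigr => T.
  rewrite mem_enum => hT; rewrite -(cardT T hT).
  by apply: fps_cell_mass => // [|t]; [exact: iT|exact: fin].
have h_ge0 n : 0 <= h n.
  rewrite /h big_seq; apply: sumr_ge0 => T; rewrite mem_enum => hT.
  by apply: cell_mass_ge0 => //; exact: iT.
have h_big n : (d.+2 <= n)%N -> h n = 0.
  move=> dn; rewrite /h big_seq big1 // => T; rewrite mem_enum => hT.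
  by rewrite /cell_mass cell_full ?mass_set0 ?T0 ?tri_I ?T0 ?cardT.
have [N hN] : exists p : {poly R}, forall t : nat, p.[t%:R] = L t.
  by apply: (@fps_mul_eventually0 _ _ d.+2) => n dn; rewrite fpsL h_big.
exists N, (\poly_(i < d.+2) h i); split.
- move=> t t0; rewrite (sumE t t0).1 hN /L -sumEFin big_seq [RHS]big_seq.
  apply: eq_bigr => T; rewrite mem_enum => hT; rewrite fineK //.
  by apply: cell_mass_fin => // [|t'|];
    [exact: iT|exact: fin|exact: finset.sub0set].
- exact: size_poly.
- move=> n; rewrite coef_poly.
  have -> : (fun t : nat => N.[t%:R]) = L by apply/funext.
  by rewrite fpsL; case: ltnP => // /h_big.
by move=> j; rewrite -ltnS coef_poly => ->.
Qed.
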